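(* Let $P(\lambda)=I+\sum_{j=1}^N\lambda^jA_j$ be a matrix polynomial with coefficients $A_j\in\mathbb{C}^{n\times n}$, and suppose that it has a factorisation $P(\lambda)=\prod_{j=1}^d(I+\lambda B_j)=(I+\lambda B_1)(I+\lambda B_2)\cdots(I+\lambda B_d)$ with $B_1,\dots,B_d\in\mathbb{C}^{n\times n}$ such that $$\sum_{1\le j<k\le d}\operatorname{tr}(\operatorname{Im}B_j\,\operatorname{Im}B_k)\ge 0 .$$ Then $$\|P(\lambda)\|_F\le n^{\frac d2}\exp\Bigl(\frac1n\operatorname{tr}\operatorname{Re}(\lambda A_1)+\frac1{2n}\bigl(\|A_1\|_F^2-2\operatorname{tr}\operatorname{Re}A_2\bigr)|\lambda|^2\Bigr)\qquad\text{for all }\lambda\in\mathbb{C}.$$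
   Context: For $X\in\mathbb{C}^{n\times n}$: $\operatorname{Re}X=\frac12(X+X^* )$, $\operatorname{Im}X=\frac1{2i}(X-X^* )$, and $\|X\|_F=\sqrt{\operatorname{tr}(X^*X)}$ is the Frobenius norm. $A_1,A_2$ are the coefficients of $\lambda,\lambda^2$ in $P$ (zero if absent). The number $d$ of factors may be larger than the degree of $P$. *)

(* Defs.v *)
From mathcomp Require Import all_boot all_order all_algebra.
From mathcomp Require Import complex.
From mathcomp Require Import all_classical all_reals all_analysis.
Set Implicit Arguments.
Unset Strict Implicit.
Unset Printing Implicit Defensive.
Import Order.TTheory GRing.Theory Num.Theory.
Local Open Scope ring_scope.
Local Open Scope sesquilinear_scope.

Definition mxRe (R : realType) (n : nat) (X : 'M[R[i]]_n) : 'M[R[i]]_n :=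
  2%:R^-1 *: (X + X ^t* ).

Definition mxIm (R : realType) (n : nat) (X : 'M[R[i]]_n) : 'M[R[i]]_n :=
  (2%:R * 'i)^-1 *: (X - X ^t* ).

(* [\tr (X^* X)] is a real nonnegative element of [R[i]]; [complex.Re] only
   transports it to [R]. *)
Definition frob (R : realType) (n : nat) (X : 'M[R[i]]_n) : R :=
  Num.sqrt (complex.Re (\tr (X ^t* *m X))).

(* Main.v *)
Require Import Defs.
From mathcomp Require Import all_boot all_order all_algebra.
From mathcomp Require Import complex.
From mathcomp Require Import all_classical all_reals all_analysis.
From mathcomp Require Import ring lra.
Import Order.TTheory GRing.Theory Num.Theory.
Local Open Scope ring_scope.

(** Two elementary bounds give the estimate.  The Frobenius norm is
    submultiplicative, so the norm of P(lambda) is at most the product of the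
    norms of I + lambda B_j; and each factor satisfies
      |I + X|_F^2 = n (1 + x) <= n e^x,  x = (2 Re tr X + |X|_F^2) / n.
    The product of these bounds is n^(d/2) times the exponential of
      Re tr (lambda A_1) / n + |lambda|^2 (sum_j |B_j|_F^2) / (2 n),
    because A_1 is the sum of the B_j ([frob_1D_le], [frob_prod]).

    It remains to bound sum_j |B_j|_F^2 by |A_1|_F^2 - 2 Re tr A_2, which is
    where the condition on the imaginary parts enters.  The square of A_1
    expands into the diagonal terms |B_j|_F^2 and the cross terms
    2 Re tr (B_j^* B_k), j < k, while A_2 is the sum of the B_j B_k, j < k.
    Hence the two sides differ by twice the sum of
      Re tr (B_j^* B_k) - Re tr (B_j B_k) = 2 Re tr (Im B_j Im B_k)
    over j < k ([Re_tr_mxIm], [sum_frob_sq_le]), which is nonnegative. *)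

(** * Sums over pairs of indices and coefficients of the product *)

Section Triangular.
Variable V : zmodType.

Lemma sum_lt_recl d (f : 'I_d.+1 -> 'I_d.+1 -> V) :
  \sum_(j < d.+1) \sum_(k < d.+1 | (j < k)%N) f j k
  = \sum_(k < d) f ord0 (lift ord0 k)
    + \sum_(j < d) \sum_(k < d | (j < k)%N) f (lift ord0 j) (lift ord0 k).
Proof.
rewrite big_ord_recl; congr (_ + _).
  by rewrite big_mkcond big_ord_recl /= add0r; apply: eq_bigr.
apply: eq_bigr => j _; rewrite big_mkcond big_ord_recl /= add0r.
by rewrite [RHS]big_mkcond; apply: eq_bigr.
Qed.

Lemma sum_square_lt d (f : 'I_d -> 'I_d -> V) :
  \sum_(j < d) \sum_(k < d) f j k
  = \sum_(j < d) f j j + \sum_(j < d) \sum_(k < d | (j < k)%N) (f j k + f k j).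
Proof.
elim: d f => [|d IH] f; first by rewrite !big_ord0 addr0.
rewrite sum_lt_recl !big_ord_recl.
under [X in _ + X = _]eq_bigr do rewrite big_ord_recl.
rewrite !big_split /= IH -!addrA; congr (_ + _).
by rewrite [RHS]addrCA; congr (_ + _); rewrite addrCA.
Qed.

End Triangular.

(** In a noncommutative ring the order of the factors matters: the coefficient
    of degree two collects b_j b_k with the smaller index on the left.  The
    constant coefficient is what carries the induction. *)
Lemma coef_prod_1DX (S : nzRingType) d (b : 'I_d -> S) :
  let Q := \prod_(j < d) (1 + (b j)%:P * 'X) in
  [/\ Q`_0 = 1, Q`_1 = \sum_(j < d) b j
    & Q`_2 = \sum_(j < d) \sum_(k < d | (j < k)%N) b j * b k].
Proof.
elim: d b => [|d IH] b /=; first by rewrite !big_ord0 !coef1.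
have [Q0 Q1 Q2] := IH (fun j => b (lift ord0 j)).
rewrite sum_lt_recl !big_ord_recl mulrDl mul1r -mulrA -commr_polyX !coefD.
rewrite !coefCM !coefMX /= Q0 Q1 Q2 mulr0 addr0 mulr1 addrC mulr_sumr.
by rewrite [X in [/\ _, _ & X = _]]addrC.
Qed.

(** * The Frobenius norm *)

Section Frobenius.
Local Open Scope sesquilinear_scope.
Variable R : realType.
Local Notation C := R[i].

Lemma trmxCM m n p (A : 'M[C]_(m, n)) (B : 'M[C]_(n, p)) :
  (A *m B) ^t* = B ^t* *m A ^t*.
Proof. by rewrite trmx_mul map_mxM. Qed.

Lemma Re_tr_trmxC n (X : 'M[C]_n) :
  complex.Re (\tr (X ^t*)) = complex.Re (\tr X).
Proof. by rewrite -map_trmx mxtrace_tr trace_map_mx; case: (\tr X). Qed.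

(** The real inner product underlying [frob]; taking the real part makes it
    symmetric. *)
Definition frob_dot {n} (X Y : 'M[C]_n) : R := complex.Re (\tr (X ^t* *m Y)).

Lemma frob_dotC n (X Y : 'M[C]_n) : frob_dot X Y = frob_dot Y X.
Proof. by rewrite /frob_dot -Re_tr_trmxC trmxCM trmxCK. Qed.

Lemma frob_dotDr n (X Y Z : 'M[C]_n) :
  frob_dot X (Y + Z) = frob_dot X Y + frob_dot X Z.
Proof. by rewrite /frob_dot mulmxDr !raddfD. Qed.

Lemma tr_trmxCM n (X Y : 'M[C]_n) :
  \tr (X ^t* *m Y) = \sum_i \sum_j (X j i)^* * Y j i.
Proof.
by apply: eq_bigr => i _; rewrite !mxE; apply: eq_bigr => j _; rewrite !mxE.
Qed.

Lemma tr_trmxC_ge0 n (X : 'M[C]_n) : 0 <= \tr (X ^t* *m X).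
Proof.
by rewrite tr_trmxCM; do 2!apply: sumr_ge0 => ? _; rewrite mulrC mul_conjC_ge0.
Qed.

Lemma sq_frob n (X : 'M[C]_n) : frob X ^+ 2 = frob_dot X X.
Proof.
by rewrite sqr_sqrtr //; have := tr_trmxC_ge0 n X; rewrite lecE => /andP[].
Qed.

Lemma frob_ge0 n (X : 'M[C]_n) : 0 <= frob X.
Proof. exact: sqrtr_ge0. Qed.

(** The entry (i, j) of X Y is the inner product of row i of X with row j of
    the adjoint of Y, so the Cauchy-Schwarz inequality bounds its square by the
    product of two squared norms; summing over i and j separates the factors. *)
Lemma frobM n (X Y : 'M[C]_n) : frob (X *m Y) <= frob X * frob Y.
Proof.
rewrite -(@ler_sqr R) ?nnegrE ?mulr_ge0 ?frob_ge0 // exprMn !sq_frob.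
have key : \tr ((X *m Y)^t* *m (X *m Y)) <= \tr (X ^t* *m X) * \tr (Y ^t* *m Y).
  have -> : \tr (X ^t* *m X) = \sum_i dotmx (row i X) (row i X).
    rewrite tr_trmxCM exchange_big; apply: eq_bigr => i _.
    by rewrite dotmxE mxE; apply: eq_bigr => j _; rewrite !mxE mulrC.
  have -> : \tr (Y ^t* *m Y) = \sum_j dotmx (row j (Y ^t*)) (row j (Y ^t*)).
    apply: eq_bigr => i _.
    by rewrite dotmxE !mxE; apply: eq_bigr => j _; rewrite !mxE conjCK.
  rewrite tr_trmxCM exchange_big mulr_suml; apply: ler_sum => i _.
  rewrite mulr_sumr; apply: ler_sum => j _; rewrite mulrC -normCK.
  have -> : (X *m Y) i j = dotmx (row i X) (row j (Y ^t*)).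
    by rewrite dotmxE !mxE; apply: eq_bigr => k _; rewrite !mxE conjCK.
  by have [] := CauchySchwarz (@dotmx C n) (row i X) (row j (Y ^t*)).
(* Both traces are real, so the real part of their product factors. *)
have := key; rewrite -[X in _ <= _ * X]RRe_real ?ger0_real ?tr_trmxC_ge0 //.
rewrite -[X in _ <= X * _]RRe_real ?ger0_real ?tr_trmxC_ge0 // -rmorphM lecE.
by case/andP.
Qed.

(** The empty product is excluded because the identity matrix has norm
    sqrt n, not 1. *)
Lemma frob_prod n d (F : 'I_d -> 'M[C]_n.+1) : (0 < d)%N ->
  frob (\prod_(j < d) F j) <= \prod_(j < d) frob (F j).
Proof.
case: d F => // d F _; elim: d F => [|d IH] F.
  by rewrite !big_ord_recl !big_ord0 !mulr1.
rewrite big_ord_recl [leRHS]big_ord_recl; apply: le_trans (frobM _ _ _) _.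
by apply: ler_wpM2l; [exact: frob_ge0 | exact: IH].
Qed.

Lemma frob_dot_sumr n d (Y : 'M[C]_n) (B : 'I_d -> 'M[C]_n) :
  frob_dot Y (\sum_j B j) = \sum_j frob_dot Y (B j).
Proof.
apply: (big_morph (frob_dot Y)); first exact: frob_dotDr.
by rewrite /frob_dot mulmx0 mxtrace0.
Qed.

Lemma frob_sum_sq n d (B : 'I_d -> 'M[C]_n) :
  frob (\sum_j B j) ^+ 2
  = \sum_j frob (B j) ^+ 2
    + 2 * \sum_(j < d) \sum_(k < d | (j < k)%N) frob_dot (B j) (B k).
Proof.
rewrite sq_frob frob_dot_sumr.
under eq_bigr do rewrite frob_dotC frob_dot_sumr.
rewrite sum_square_lt; congr (_ + _).
  by apply: eq_bigr => j _; rewrite sq_frob.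
rewrite mulr_sumr; apply: eq_bigr => j _.
rewrite mulr_sumr; apply: eq_bigr => k _.
by rewrite mulr_natl mulr2n [X in _ + X]frob_dotC.
Qed.

Lemma frob_1D_sq n (X : 'M[C]_n.+1) :
  frob (1 + X) ^+ 2 = n.+1%:R + 2 * complex.Re (\tr X) + frob X ^+ 2.
Proof.
have dot1 Y : frob_dot 1 Y = complex.Re (\tr Y).
  by rewrite /frob_dot trmx1 map_mx1 mul1mx.
rewrite !sq_frob frob_dotDr [X in X + _]frob_dotC [X in _ + X]frob_dotC.
rewrite !frob_dotDr [frob_dot X 1]frob_dotC !dot1 mxtrace1 raddfMn /=.
ring.
Qed.

Lemma Re_realM (a : R) (z : C) : complex.Re (a%:C%C * z) = a * complex.Re z.
Proof. by case: z => x y /=; rewrite mul0r subr0. Qed.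

Lemma Re_tr_mxRe n (X : 'M[C]_n) :
  complex.Re (\tr (mxRe X)) = complex.Re (\tr X).
Proof.
have -> : mxRe X = (2^-1)%:C%C *: (X + X ^t*).
  by rewrite rmorphV ?unitfE ?pnatr_eq0 // rmorph_nat.
by rewrite mxtraceZ Re_realM mxtraceD raddfD /= Re_tr_trmxC; lra.
Qed.

(** Expanding (X - X^* )(Y - Y^* ) gives four traces; up to conjugation and
    cyclicity tr (X^* Y^* ) agrees with tr (X Y), and tr (X Y^* ) with
    tr (X^* Y), so their real parts pair up. *)
Lemma Re_tr_mxIm n (X Y : 'M[C]_n) :
  2 * complex.Re (\tr (mxIm X *m mxIm Y))
  = frob_dot X Y - complex.Re (\tr (X *m Y)).
Proof.
rewrite /mxIm -scalemxAl -scalemxAr scalerA.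
have -> : (2 * 'i)^-1 * (2 * 'i)^-1 = (- 4^-1)%:C%C :> C.
  rewrite -invfM -expr2 exprMn sqrCi mulrN1 invrN -natrX.
  by rewrite rmorphN rmorphV ?unitfE ?pnatr_eq0 // rmorph_nat.
rewrite mxtraceZ Re_realM mulmxBl !mulmxBr 3!(linearB mxtrace) !raddfB /=.
have -> : complex.Re (\tr (X ^t* *m Y ^t*)) = complex.Re (\tr (X *m Y)).
  by rewrite -trmxCM Re_tr_trmxC mxtrace_mulC.
have -> : complex.Re (\tr (X *m Y ^t*)) = frob_dot X Y.
  by rewrite mxtrace_mulC -/(frob_dot Y X) frob_dotC.
rewrite -/(frob_dot X Y); lra.
Qed.

Lemma frobZ_sq n (c : C) (X : 'M[C]_n) :
  frob (c *: X) ^+ 2 = complex.Re `|c| ^+ 2 * frob X ^+ 2.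
Proof.
rewrite !sq_frob /frob_dot [(c *: X)^T]linearZ /= map_mxZ.
rewrite -scalemxAl -scalemxAr scalerA mxtraceZ.
by rewrite [X in complex.Re (X * _)]mulrC -normCK -Re_realM rmorphXn.
Qed.

(** Evaluation is not multiplicative over a noncommutative ring in general;
    it is at a scalar matrix, which commutes with every coefficient. *)
Lemma horner_scalar_prod1DX n d (b : 'I_d -> 'M[C]_n.+1) (lam : C) :
  (\prod_(j < d) (1 + (b j)%:P * 'X)).[lam%:M] = \prod_(j < d) (1 + lam *: b j).
Proof.
have comm_scalar (p : {poly 'M[C]_n.+1}) : comm_poly p lam%:M.
  by rewrite /comm_poly; apply/esym/scalar_mxC.
elim: d b => [|d IH] b; first by rewrite !big_ord0 hornerE.
rewrite !big_ord_recl hornerM_comm // IH; congr (_ * _).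
by rewrite hornerD hornerMX !hornerC; congr (_ + _); rewrite -mul_mx_scalar.
Qed.

Lemma Re_tr_sum n (I : Type) (r : seq I) (Q : pred I) (F : I -> 'M[C]_n) :
  complex.Re (\tr (\sum_(i <- r | Q i) F i))
  = \sum_(i <- r | Q i) complex.Re (\tr (F i)).
Proof. by rewrite (raddf_sum mxtrace) (raddf_sum (@complex.Re R)). Qed.

(** The difference of the two sides is four times the sum in the hypothesis:
    a factor 2 comes from the cross terms of the square, another one from
    [Re_tr_mxIm]. *)
Lemma sum_frob_sq_le n d (B : 'I_d -> 'M[C]_n) :
  0 <= \sum_(j < d) \sum_(k < d | (j < k)%N) \tr (mxIm (B j) *m mxIm (B k)) ->
  \sum_(j < d) frob (B j) ^+ 2
  <= frob (\sum_(j < d) B j) ^+ 2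
     - 2 * complex.Re (\tr (\sum_(j < d) \sum_(k < d | (j < k)%N) B j *m B k)).
Proof.
rewrite lecE => /andP[_ /= ImB_ge0].
rewrite frob_sum_sq -addrA lerDl -mulrBr mulr_ge0 //.
suff -> : \sum_(j < d) \sum_(k < d | (j < k)%N) frob_dot (B j) (B k)
    - complex.Re (\tr (\sum_(j < d) \sum_(k < d | (j < k)%N) B j *m B k))
    = 2 * complex.Re (\sum_(j < d) \sum_(k < d | (j < k)%N)
                        \tr (mxIm (B j) *m mxIm (B k))) by rewrite mulr_ge0.
rewrite Re_tr_sum (raddf_sum (@complex.Re R)) -sumrB mulr_sumr.
apply: eq_bigr => j _.
rewrite Re_tr_sum (raddf_sum (@complex.Re R)) -sumrB mulr_sumr.
by apply: eq_bigr => k _; rewrite Re_tr_mxIm.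
Qed.

(** This is 1 + x <= e^x applied to the square of the norm, divided by n. *)
Lemma frob_1D_le n (X : 'M[C]_n.+1) :
  frob (1 + X) <= Num.sqrt n.+1%:R
    * expR ((2 * n.+1%:R)^-1 * (2 * complex.Re (\tr X) + frob X ^+ 2)).
Proof.
rewrite -(@ler_sqr R) ?nnegrE ?mulr_ge0 ?frob_ge0 ?sqrtr_ge0 ?expR_ge0 //.
rewrite frob_1D_sq exprMn [Num.sqrt _%:R ^+ 2]sqr_sqrtr ?ler0n // -expRM_natl.
set x := _ * (_ * _); set N := n.+1%:R : R.
have N_gt0 : 0 < N by rewrite ltr0n.
have -> : N + 2 * complex.Re (\tr X) + frob X ^+ 2 = N * (1 + x).
  by rewrite /x; field; rewrite gt_eqF.
by rewrite ler_pM2l // expR_ge1Dx.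
Qed.

End Frobenius.

(** * The bound for the matrix polynomial *)

(* The size of the matrices is n.+1.  P is evaluated at lam : R[i] through the
   scalar matrix lam%:M.  The order on R[i] is partial: 0 <= z says that z is
   real and nonnegative; complex.Re : R[i] -> R is applied to traces of
   Hermitian matrices and to moduli, which are real. *)
Theorem theorem4p2 (R : realType) (n N d : nat)
    (A : nat -> 'M[R[i]]_n.+1) (B : 'I_d -> 'M[R[i]]_n.+1)
    (P : {poly 'M[R[i]]_n.+1})
    (d_gt0 : (0 < d)%N)
    (PE : P = 1 + \sum_(1 <= j < N.+1) (A j)%:P * 'X^j)
    (PB : P = \prod_(j < d) (1 + (B j)%:P * 'X))
    (ImB : 0 <= \sum_(j < d) \sum_(k < d | (j < k)%N)
                  \tr (mxIm (B j) *m mxIm (B k)))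
    (lam : R[i]) :
  frob P.[lam%:M] <=
    n.+1%:R `^ (d%:R / 2%:R)
    * expR (n.+1%:R^-1 * complex.Re (\tr (mxRe (lam *: P`_1)))
            + (2%:R * n.+1%:R)^-1
              * (frob P`_1 ^+ 2 - 2%:R * complex.Re (\tr (mxRe P`_2)))
              * complex.Re `|lam| ^+ 2).
Proof.
have [_ P1 P2] := coef_prod_1DX _ _ B; rewrite -PB in P1 P2.
have sumB := sum_frob_sq_le _ _ _ _ ImB; rewrite -P1 -P2 in sumB.
have frobP : frob P.[lam%:M] <= \prod_j frob (1 + lam *: B j).
  by rewrite PB horner_scalar_prod1DX; exact: frob_prod.
apply: le_trans frobP _; set m := n.+1%:R : R.
have m_gt0 : 0 < m by rewrite ltr0n.
have -> : m `^ (d%:R / 2%:R) = \prod_(j < d) Num.sqrt m.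
  rewrite prodr_const card_ord mulrC powRrM powR12_sqrt ?ltW //.
  by rewrite powR_mulrn ?sqrtr_ge0.
apply: (@le_trans _ _ (\prod_(j < d) (Num.sqrt m * expR ((2 * m)^-1 *
    (2 * complex.Re (\tr (lam *: B j)) + frob (lam *: B j) ^+ 2))))).
  by apply: ler_prod => j _; rewrite frob_ge0 frob_1D_le.
rewrite big_split /=; apply: ler_wpM2l.
  by apply: prodr_ge0 => j _; exact: sqrtr_ge0.
rewrite -expR_sum ler_expR -mulr_sumr big_split /= -mulr_sumr.
rewrite -Re_tr_sum -scaler_sumr -P1 !Re_tr_mxRe.
under eq_bigr do rewrite frobZ_sq.
rewrite -mulr_sumr mulrDr lerD //.
  by rewrite le_eqVlt; apply/orP; left; apply/eqP; field; rewrite gt_eqF.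
rewrite -mulrA; apply: ler_wpM2l; first by rewrite invr_ge0 mulr_ge0 ?ltW.
by rewrite [leRHS]mulrC; apply: ler_wpM2l; rewrite ?sqr_ge0.
Qed.
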